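(* Let $\mathscr{C}$ be a class of finite simple undirected graphs that has low rankwidth covers and a stable edge relation. Then $\mathscr{C}$ is linearly $\chi$-bounded: there is a constant $c$ such that $\chi(H)\le c\,\omega(H)$ for every induced subgraph $H$ of every graph in $\mathscr{C}$.
   Context: A class $\mathscr{C}$ has low rankwidth covers if for every positive integer $p$ there are a constant $C_p$ and a class $\mathscr{X}_p$ of bounded rankwidth such that every $G\in\mathscr{C}$ can be covered by $C_p$ induced subgraphs $H_1,\dots,H_{C_p}\in\mathscr{X}_p$ so that every set of $p$ vertices of $G$ is contained in $V(H_i)$ for some $i$. $\mathscr{C}$ has a stable edge relation if there is $t$ such that no graph in $\mathscr{C}$ contains the half-graph of order $t$ (vertices $a_1,\dots,a_t,b_1,\dots,b_t$, edges $a_ib_j$ for $i\le j$) as a semi-induced subgraph, i.e. isomorphic to $G[X,Y]$ for disjoint $X,Y\subseteq V(G)$, where $G[X,Y]$ has vertex set $X\cup Y$ and exactly the edges of $G$ between $X$ and $Y$. $\chi$ denotes chromatic number and $\omega$ clique number. *)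

(* Defs.v *)
From mathcomp Require Import all_boot all_order all_algebra.

Set Implicit Arguments.
Unset Strict Implicit.
Unset Printing Implicit Defensive.

Record sgraph := SGraph {
  vertex :> finType;
  adj : rel vertex;
  adj_sym : symmetric adj;
  adj_irrefl : irreflexive adj }.

(* Not required to be closed under isomorphism. *)
Definition graph_class := sgraph -> Prop.

Definition isomorphic (G H : sgraph) : Prop :=
  exists2 f : G -> H, bijective f & forall x y, adj (f x) (f y) = adj x y.

Definition induced_adj (G : sgraph) (A : {set G}) : rel {x : G | x \in A} :=
  fun u v => adj (val u) (val v).

Lemma induced_adj_sym (G : sgraph) (A : {set G}) : symmetric (@induced_adj G A).
Proof. by move=> u v; rewrite /induced_adj adj_sym. Qed.

Lemma induced_adj_irrefl (G : sgraph) (A : {set G}) : irreflexive (@induced_adj G A).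
Proof. by move=> u; rewrite /induced_adj adj_irrefl. Qed.

Definition induced (G : sgraph) (A : {set G}) : sgraph :=
  SGraph (@induced_adj_sym G A) (@induced_adj_irrefl G A).

(* For disjoint X and Y, between X Y is the bipartite graph G[X,Y]. *)
Definition between_adj (G : sgraph) (X Y : {set G}) : rel {x : G | x \in X :|: Y} :=
  fun u v => adj (val u) (val v) &&
    ((val u \in X) && (val v \in Y) || (val u \in Y) && (val v \in X)).

Lemma between_adj_sym (G : sgraph) (X Y : {set G}) : symmetric (@between_adj G X Y).
Proof.
move=> u v; rewrite /between_adj adj_sym orbC.
by rewrite (andbC (val u \in Y)) (andbC (val u \in X)).
Qed.

Lemma between_adj_irrefl (G : sgraph) (X Y : {set G}) : irreflexive (@between_adj G X Y).
Proof. by move=> u; rewrite /between_adj adj_irrefl. Qed.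

Definition between (G : sgraph) (X Y : {set G}) : sgraph :=
  SGraph (@between_adj_sym G X Y) (@between_adj_irrefl G X Y).

Definition semi_induced_subgraph (H G : sgraph) : Prop :=
  exists X Y : {set G}, [disjoint X & Y] /\ isomorphic H (between X Y).

(* inl i is a_i and inr j is b_j. *)
Definition half_adj (t : nat) : rel ('I_t + 'I_t)%type := fun u v =>
  match u, v with
  | inl i, inr j => i <= j
  | inr j, inl i => i <= j
  | _, _ => false
  end.

Lemma half_adj_sym t : symmetric (@half_adj t).
Proof. by case=> i [] j. Qed.

Lemma half_adj_irrefl t : irreflexive (@half_adj t).
Proof. by case. Qed.

Definition half_graph (t : nat) : sgraph :=
  SGraph (@half_adj_sym t) (@half_adj_irrefl t).

Definition stable_edge_relation (C : graph_class) : Prop :=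
  exists t : nat,
    forall G : sgraph, C G -> ~ semi_induced_subgraph (half_graph t) G.

Definition colorable (G : sgraph) (k : nat) : bool :=
  [exists f : {ffun G -> 'I_k}, forall x, forall y, adj x y ==> (f x != f y)].

Lemma colorable_card (G : sgraph) : exists k, colorable G k.
Proof.
exists #|G|; apply/existsP; exists [ffun x => enum_rank x].
apply/forallP => x; apply/forallP => y; apply/implyP => xy.
rewrite !ffunE (inj_eq enum_rank_inj).
by apply: contraTneq xy => ->; rewrite adj_irrefl.
Qed.

Definition chi (G : sgraph) : nat := ex_minn (colorable_card G).

Definition clique (G : sgraph) (A : {set G}) : bool :=
  [forall x in A, forall y in A, (x != y) ==> adj x y].

Definition omega (G : sgraph) : nat := \max_(A : {set G} | clique A) #|A|.

Definition linearly_chi_bounded (C : graph_class) : Prop :=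
  exists c : nat, forall G : sgraph, C G ->
    forall A : {set G}, chi (induced A) <= c * omega (induced A).

Definition degree (G : sgraph) (x : G) : nat := #|[set y | adj x y]|.

Definition leaves (T : sgraph) : {set T} := [set x | degree x == 1].

Definition is_tree (T : sgraph) : Prop :=
  [/\ 0 < #|T|,
      forall x y : T, connect (@adj T) x y
    & forall c : seq T, ucycle (@adj T) c -> size c <= 2].

Definition cut_rank (G : sgraph) (A : {set G}) : nat :=
  \rank (\matrix_(i < #|A|, j < #|~: A|)
           ((adj (enum_val i) (enum_val j))%:R : 'F_2))%R.

Definition adj_minus_edge (T : sgraph) (x y : T) : rel T :=
  fun u v => adj u v && ([set u; v] != [set x; y]).

Definition rank_decomposition (G T : sgraph) (L : G -> T) : Prop :=
  [/\ is_tree T,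
      forall x : T, degree x <= 3,
      injective L
    & L @: [set: G] = leaves T].

(* The vertices of G on the x side of the tree edge xy. *)
Definition edge_part (G T : sgraph) (L : G -> T) (x y : T) : {set G} :=
  [set v | connect (adj_minus_edge x y) x (L v)].

(* No tree has exactly one leaf, so graphs with at most one vertex are put in
   separately, with rankwidth 0 by convention. *)
Definition rankwidth_at_most (G : sgraph) (k : nat) : Prop :=
  #|G| <= 1 \/
  exists (T : sgraph) (L : G -> T), rank_decomposition L /\
    forall x y : T, adj x y -> cut_rank (edge_part L x y) <= k.

Definition bounded_rankwidth (X : graph_class) : Prop :=
  exists k : nat, forall G : sgraph, X G -> rankwidth_at_most G k.

Definition low_rankwidth_covers (C : graph_class) : Prop :=
  forall p : nat, 0 < p ->
  exists (N : nat) (X : graph_class), bounded_rankwidth X /\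
    forall G : sgraph, C G ->
    exists H : 'I_N -> {set G},
      [/\ forall i, X (induced (H i)),
          \bigcup_i H i = [set: G]
        & forall S : {set G}, #|S| = p -> exists i, S \subset H i].

(* Main.v *)
From mathcomp Require Import all_boot all_algebra.
Require Import Defs.

(** With [p = 1] it suffices to partition every graph of rankwidth at most [k]
without a half-graph of order [t] into boundedly many cographs, since [chi <=
omega] on cographs.

The rank decomposition yields a laminar family [F] of vertex sets, each split in
two inside [F], such that the vertices of each [X] in [F] leave at most [n]
traces (neighbourhoods) outside [X]; the proof is by induction on [n].  For [X]
in [F] and [v] in [X], the exit of [X] at [v] is the largest proper subset [Y] of
[X] in [F] that contains [v] and all of whose vertices have the same trace
outside [X]; the block of [v] is the set of vertices of [Y] with the same trace
as [v] outside [Y].  Keep one representative per block, among those with a given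
trace outside [X] and at most one in each exit.  Members of [F] that lie strictly
between [X] and its exits have vertices with two different traces outside [X], so
restricting to these representatives lowers [n]: by induction the quotient of [X]
by blocks has a bounded partition into cographs.

Each vertex [v] thus reads a word along the chain of iterated exits starting from
the whole graph.  The letter at [X] tells whether [v] is anticomplete or complete
to [X] outside its exit, and records the colour of its block in the quotient when
it is neither.  Compress each run of equal (anti)complete letters to its length
modulo 2.  Vertices with equal compressed words induce a cograph, obtained by
substitution, and a long compressed word gives a long alternation of vertices
complete and anticomplete to a decreasing chain of sets, hence a half-graph. *)

Set Implicit Arguments.
Unset Strict Implicit.
Unset Printing Implicit Defensive.

(** * Cographs *)

Section Cographs.

Variables (T : finType) (e : rel T).

Definition homogeneous (b : bool) (A B : {set T}) : Prop :=
  forall x y, x \in A -> y \in B -> e x y = b.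

Inductive cograph : {set T} -> Prop :=
| cograph0 : cograph set0
| cograph1 x : cograph [set x]
| cographU b (A B : {set T}) : [disjoint A & B] -> homogeneous b A B ->
    cograph A -> cograph B -> cograph (A :|: B).

Lemma cographS (A B : {set T}) : cograph B -> A \subset B -> cograph A.
Proof.
move=> cogB; elim: cogB A => [A|x A|b B1 B2 dB hB _ IH1 _ IH2 A sAB].
- by rewrite subset0 => /eqP ->; apply: cograph0.
- by rewrite subset1 => /orP[] /eqP ->; [apply: cograph1 | apply: cograph0].
have -> : A = (A :&: B1) :|: (A :&: B2).
  by rewrite -setIUr; apply/esym/setIidPl.
apply: (@cographU b); first 1 last.
- by move=> x y /setIP[_ xB] /setIP[_ yB]; apply: hB.
- by apply: IH1; apply: subsetIr.
- by apply: IH2; apply: subsetIr.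
apply: disjointWl (subsetIr _ _) _; apply: disjointWr (subsetIr _ _) _.
exact: dB.
Qed.

Lemma cograph_constant (b : bool) (A : {set T}) :
  (forall x y, e x y = b) -> cograph A.
Proof.
move=> eb; move: {2}#|A| (leqnn #|A|) => n.
elim: n A => [A|n IH A leA].
  by rewrite leqn0 cards_eq0 => /eqP ->; apply: cograph0.
have [->|[x xA]] := set_0Vmem A; first exact: cograph0.
rewrite -(setD1K xA); apply: (@cographU b).
- by rewrite disjoints1 setD11.
- by move=> y z _ _; apply: eb.
- exact: cograph1.
by apply: IH; rewrite (cardsD1 x) xA in leA.
Qed.

Lemma cograph_coloring (A : {set T}) :
  symmetric e -> irreflexive e -> cograph A ->
  exists (f : T -> nat) (K : {set T}), [/\ K \subset A,
    {in K &, forall x y, x != y -> e x y},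
    {in A, forall x, f x < #|K|}
    & {in A &, forall x y, e x y -> f x != f y}].
Proof.
move=> sym irr.
elim=> [|z|b {}A B dAB hAB _ [f [K [sK cK fK pf]]] _ [g [L [sL cL gL pg]]]].
- exists (fun=> 0), set0; split=> // [x y|x|x y]; by rewrite inE.
- exists (fun=> 0), [set z]; split=> // [x y|x|x y].
  + by rewrite !inE => /eqP -> /eqP ->; rewrite eqxx.
  + by rewrite cards1.
  by rewrite !inE => /eqP -> /eqP ->; rewrite irr.
have notA x : x \in B -> (x \in A) = false by move=> /(disjointFl dAB).
have dKL : [disjoint K & L].
  by apply: disjointWl sK _; apply: disjointWr sL _.
case: b hAB => hAB.
- exists (fun x => if x \in A then f x else #|K| + g x), (K :|: L).
  have cKL : #|K :|: L| = #|K| + #|L|.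
    by apply/eqP; rewrite (leq_card_setU K L).2.
  split=> [|x y|x|x y].
  + exact: setUSS.
  + move=> /setUP[] xK /setUP[] yK neq.
    * exact: cK.
    * by apply: hAB; [apply: (subsetP sK) | apply: (subsetP sL)].
    * by rewrite sym; apply: hAB; [apply: (subsetP sK) | apply: (subsetP sL)].
    * exact: cL.
  + rewrite cKL => /setUP[xA|xB]; first by rewrite xA ltn_addr ?fK.
    by rewrite notA // ltn_add2l gL.
  move=> /setUP[xA|xB] /setUP[yA|yB] exy; rewrite ?xA ?yA ?(notA _ xB) ?(notA _ yB).
  + exact: pf.
  + by rewrite neq_ltn ltn_addr ?fK.
  + by rewrite neq_ltn ltn_addr ?fK ?orbT.
  by rewrite eqn_add2l pg.
pose M := if #|K| <= #|L| then L else K.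
exists (fun x => if x \in A then f x else g x), M.
have [KM LM] : #|K| <= #|M| /\ #|L| <= #|M|.
  by rewrite /M; case: (leqP #|K| #|L|) => // /ltnW.
split=> [|||x y].
- rewrite /M; case: ifP => _; first exact: subset_trans sL (subsetUr _ _).
  exact: subset_trans sK (subsetUl _ _).
- by rewrite /M; case: ifP.
- move=> x /setUP[xA|xB]; first by rewrite xA (leq_trans (fK _ _)).
  by rewrite notA // (leq_trans (gL _ _)).
move=> /setUP[xA|xB] /setUP[yA|yB] exy; rewrite ?xA ?yA ?(notA _ xB) ?(notA _ yB).
- exact: pf.
- by rewrite hAB in exy.
- by rewrite sym hAB in exy.
exact: pg.
Qed.

End Cographs.

Lemma cograph_substitution (T K : finType) (e : rel T) (e' : rel K)
    (g : T -> K) (R : {set K}) (A : {set T}) :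
  cograph e' R -> {in A, forall x, g x \in R} ->
  {in A &, forall x y, g x != g y -> e x y = e' (g x) (g y)} ->
  (forall k, k \in R -> cograph e [set x in A | g x == k]) ->
  cograph e A.
Proof.
move=> cR; elim: cR A => [A gA _|k A gA _|b R1 R2 dR hR _ IH1 _ IH2 A gA eA] fib.
- have -> : A = set0; last exact: cograph0.
  by apply/setP=> x; rewrite inE; apply/negP => /gA; rewrite inE.
- apply: cographS (fib k (set11 k)) _.
  by apply/subsetP => x xA; rewrite inE xA; have := gA x xA; rewrite inE.
have -> : A = [set x in A | g x \in R1] :|: [set x in A | g x \in R2].
  apply/setP=> x; rewrite !inE -andb_orr.
  by case xA: (x \in A) => //=; have := gA x xA; rewrite inE.
apply: (@cographU _ _ b).
- rewrite -setI_eq0; apply/eqP/setP=> x; rewrite !inE.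
  apply/negP => /andP[/andP[_ x1] /andP[_ x2]].
  by have := disjointFr dR x1; rewrite x2.
- move=> x y; rewrite !inE => /andP[xA x1] /andP[yA y2].
  rewrite eA ?hR //; apply: contraTneq y2 => <-.
  by rewrite (disjointFr dR x1).
- apply: IH1 => [x|x y|k k1].
  + by rewrite inE => /andP[].
  + by rewrite !inE => /andP[xA _] /andP[yA _]; apply: eA.
  apply: cographS (fib k _) _; first by rewrite inE k1.
  by apply/subsetP => x; rewrite !inE -andbA => /and3P[-> _ ->].
apply: IH2 => [x|x y|k k1].
+ by rewrite inE => /andP[].
+ by rewrite !inE => /andP[xA _] /andP[yA _]; apply: eA.
apply: cographS (fib k _) _; first by rewrite inE k1 orbT.
by apply/subsetP => x; rewrite !inE -andbA => /and3P[-> _ ->].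
Qed.

(** * Laminar decompositions and traces *)

Record laminar_decomposition (V : finType) (U : {set V}) (F : {set {set V}}) : Prop :=
  LaminarDecomposition {
    lam_sub : forall X, X \in F -> X \subset U;
    lam_neq0 : forall X, X \in F -> X != set0;
    lam_nested : forall X Y, X \in F -> Y \in F ->
      [|| X \subset Y, Y \subset X | [disjoint X & Y]];
    lam_top : U \in F;
    lam_set1 : forall x, x \in U -> [set x] \in F;
    lam_split : forall X, X \in F -> 1 < #|X| -> exists Y Z,
      [/\ Y \in F, Z \in F, X = Y :|: Z & [disjoint Y & Z]] }.

Section Traces.

Variables (V : finType) (e : rel V).

Definition trace (U X : {set V}) (u : V) : {set V} := [set v in U :\: X | e u v].

Definition traces (U X : {set V}) : {set {set V}} := [set trace U X u | u in X].

Definition width_at_most (U : {set V}) (F : {set {set V}}) (n : nat) : Prop :=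
  forall X, X \in F -> #|traces U X| <= n.

Lemma traceS (U X Y : {set V}) u v : X \subset Y ->
  trace U X u = trace U X v -> trace U Y u = trace U Y v.
Proof.
move=> sXY /setP E; apply/setP => z; have := E z; rewrite !inE.
case zY: (z \in Y) => //=; have -> // : z \in X = false.
by apply: contraFF zY; apply: (subsetP sXY).
Qed.

Lemma trace_adj (U X : {set V}) u v z : trace U X u = trace U X v ->
  z \in U -> z \notin X -> e u z = e v z.
Proof. by move=> /setP/(_ z); rewrite !inE => E zU zX; rewrite zX zU in E. Qed.

Lemma laminar_restrict (U S : {set V}) F : laminar_decomposition U F ->
  S \subset U -> S != set0 ->
  laminar_decomposition S ([set X :&: S | X in F] :\ set0).
Proof.
move=> lamF sSU S0.
have inF' X : X \in F -> X :&: S != set0 -> X :&: S \in [set X :&: S | X in F] :\ set0.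
  by move=> XF n0; rewrite !inE n0; apply/imsetP; exists X.
split.
- by move=> X /setD1P[_ /imsetP[Y _ ->]]; apply: subsetIr.
- by move=> X /setD1P[].
- move=> X Y /setD1P[_ /imsetP[X' XF ->]] /setD1P[_ /imsetP[Y' YF ->]].
  case/or3P: (lam_nested lamF XF YF) => H.
  + by rewrite setSI.
  + by rewrite (setSI _ H) orbT.
  apply/or3P/Or33; apply: disjointWl (subsetIl _ _) _.
  by apply: disjointWr (subsetIl _ _) _.
- have US : U :&: S = S by apply/setIidPr.
  by rewrite -{1}US inF' ?US // (lam_top lamF).
- move=> x xS; have xSS : [set x] :&: S = [set x] by apply/setIidPl; rewrite sub1set.
  rewrite -xSS inF' ?(lam_set1 lamF) ?(subsetP sSU) // xSS.
  by apply/set0Pn; exists x; rewrite inE.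
move=> X0 /setD1P[n0 /imsetP[X1 XF1 defX0]] gt1.
have P1 : (X1 \in F) && (X1 :&: S == X0) by rewrite XF1 defX0 /=.
case: (@arg_minnP _ X1 (fun X => (X \in F) && (X :&: S == X0)) (fun X => #|X|) P1).
move=> X /andP[XF /eqP XS] minX.
have gtX : 1 < #|X| by apply: leq_trans gt1 _; rewrite -XS subset_leq_card ?subsetIl.
have [Y [Z [YF ZF XYZ dYZ]]] := lam_split lamF XF gtX.
have gtY : 0 < #|Y| by rewrite card_gt0 (lam_neq0 lamF).
have gtZ : 0 < #|Z| by rewrite card_gt0 (lam_neq0 lamF).
have cX : #|X| = #|Y| + #|Z|.
  by rewrite XYZ; apply/eqP; rewrite (leq_card_setU Y Z).2.
have YZS : X0 = (Y :&: S) :|: (Z :&: S) by rewrite -XS XYZ setIUl.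
exists (Y :&: S), (Z :&: S); split=> //; last first.
- apply: disjointWl (subsetIl _ _) _; exact: disjointWr (subsetIl _ _) dYZ.
- apply: inF' => //; apply/eqP=> Z0; have := minX Y.
  rewrite YF YZS Z0 setU0 eqxx cX => /(_ isT).
  by rewrite -{2}[#|Y|]addn0 leq_add2l leqNgt gtZ.
- apply: inF' => //; apply/eqP=> Y0; have := minX Z.
  rewrite ZF YZS Y0 set0U eqxx cX => /(_ isT).
  by rewrite -{2}[#|Z|]add0n leq_add2r leqNgt gtY.
Qed.

Lemma width1_cograph (U : {set V}) F :
  laminar_decomposition U F -> width_at_most U F 1 -> symmetric e -> cograph e U.
Proof.
move=> lamF w1 sym; have UF := lam_top lamF.
have tr1 X u v : X \in F -> u \in X -> v \in X -> trace U X u = trace U X v.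
  move=> XF uX vX; have /card_le1_eqP := w1 X XF.
  by apply; apply: imset_f.
have gen m (X : {set V}) : #|X| <= m -> X \in F -> cograph e X.
  elim: m X => [|m IH] X leX XF.
    by move: leX; rewrite leqn0 cards_eq0 (negbTE (lam_neq0 lamF XF)).
  have [le1|gt1] := leqP #|X| 1.
    have /set0Pn[x xX] := lam_neq0 lamF XF.
    suff -> : X = [set x] by apply: cograph1.
    apply/eqP; rewrite eq_sym eqEcard sub1set xX cards1.
    exact: le1.
  have [Y [Z [YF ZF XYZ dYZ]]] := lam_split lamF XF gt1.
  have gtY : 0 < #|Y| by rewrite card_gt0 (lam_neq0 lamF).
  have gtZ : 0 < #|Z| by rewrite card_gt0 (lam_neq0 lamF).
  have cX : #|X| = #|Y| + #|Z|.
    by rewrite XYZ; apply/eqP; rewrite (leq_card_setU Y Z).2.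
  have /set0Pn[y0 y0Y] := lam_neq0 lamF YF.
  have /set0Pn[z0 z0Z] := lam_neq0 lamF ZF.
  have YU z : z \in Y -> z \in U by apply: (subsetP (lam_sub lamF YF)).
  have ZU z : z \in Z -> z \in U by apply: (subsetP (lam_sub lamF ZF)).
  rewrite XYZ; apply: (@cographU _ _ (e y0 z0)) => //.
  - move=> y z yY zZ.
    have zY : z \notin Y by rewrite (disjointFl dYZ zZ).
    have y0Z : y0 \notin Z by rewrite (disjointFr dYZ y0Y).
    rewrite (trace_adj (tr1 Y y y0 YF yY y0Y)) ?ZU //.
    rewrite sym (trace_adj (tr1 Z z z0 ZF zZ z0Z)) ?YU //.
  - by apply: IH => //; rewrite -ltnS (leq_trans _ leX) // cX -addn1 leq_add2l.
  by apply: IH => //; rewrite -ltnS (leq_trans _ leX) // cX -add1n leq_add2r.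
exact: (gen #|U|).
Qed.

End Traces.

Section Exits.

Variables (V : finType) (e : rel V) (U : {set V}) (F : {set {set V}}).
Hypothesis lamF : laminar_decomposition U F.
Hypothesis sym : symmetric e.

Local Notation tr := (trace e U).

Definition uniform (X Y : {set V}) : bool :=
  [forall u in Y, forall w in Y, trace e U X u == trace e U X w].

Lemma uniformP (X Y : {set V}) :
  reflect {in Y &, forall u w, tr X u = tr X w} (uniform X Y).
Proof.
apply: (iffP forall_inP) => [H u w uY wY|H u uY].
  by apply/eqP; apply: (forall_inP (H u uY)).
by apply/forall_inP => w wY; apply/eqP/H.
Qed.

Definition exit_def (X : {set V}) (v : V) : {set V} :=
  [arg max_(Y > [set v] | [&& Y \in F, v \in Y, Y \proper X & uniform X Y]) #|Y|].

(* Locked because unification otherwise tries to evaluate the maximum. *)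
Fact exit_key : unit. Proof. by []. Qed.
Definition exit := locked_with exit_key exit_def.

Definition block (X : {set V}) (v : V) : {set V} :=
  [set u in exit X v | trace e U (exit X v) u == trace e U (exit X v) v].

Definition rep (X : {set V}) (v : V) : V := odflt v [pick u in block X v].

Section Node.

Variable X : {set V}.
Hypotheses (XF : X \in F) (gt1 : 1 < #|X|).

Let XU : {subset X <= U}.
Proof. by apply/subsetP/(lam_sub lamF). Qed.

Lemma exit_spec v : v \in X ->
  [/\ exit X v \in F, v \in exit X v, exit X v \proper X & uniform X (exit X v)]
  /\ (forall Y, Y \in F -> v \in Y -> Y \proper X -> uniform X Y -> Y \subset exit X v).
Proof.
move=> vX; rewrite /exit unlock /exit_def; case: arg_maxnP => [|Y /and4P[YF vY YX uY] maxY].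
  rewrite (lam_set1 lamF (XU vX)) set11 /= properEcard sub1set vX cards1 gt1 /=.
  by apply/uniformP => u w; rewrite !inE => /eqP -> /eqP ->.
split=> // Z ZF vZ ZX uZ.
have /or3P[//|YZ|dZY] := lam_nested lamF ZF YF.
  suff -> : Y = Z by [].
  by apply/eqP; rewrite eqEcard YZ; apply: maxY; rewrite ZF vZ ZX uZ.
by have := disjointFr dZY vZ; rewrite vY.
Qed.

Lemma exitF v : v \in X -> exit X v \in F.
Proof. by move=> /exit_spec[[]]. Qed.
Lemma mem_exit v : v \in X -> v \in exit X v.
Proof. by move=> /exit_spec[[]]. Qed.
Lemma exit_proper v : v \in X -> exit X v \proper X.
Proof. by move=> /exit_spec[[]]. Qed.
Lemma exit_uniform v : v \in X -> {in exit X v &, forall u w, tr X u = tr X w}.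
Proof. by move=> /exit_spec[[_ _ _ /uniformP]]. Qed.
Lemma exit_sub v : v \in X -> {subset exit X v <= X}.
Proof. by move=> vX; apply/subsetP/proper_sub/exit_proper. Qed.
Lemma exit_card v : v \in X -> #|exit X v| < #|X|.
Proof. by move=> vX; apply/proper_card/exit_proper. Qed.

Lemma exit_max Y v : Y \in F -> Y \proper X -> uniform X Y -> v \in Y -> Y \subset exit X v.
Proof.
move=> YF YX uY vY; have vX := subsetP (proper_sub YX) v vY.
by have [_ max] := exit_spec vX; apply: max.
Qed.

Lemma exit_eq u v : v \in X -> u \in exit X v -> exit X u = exit X v.
Proof.
move=> vX uv; have uX := exit_sub vX uv.
have sub : exit X v \subset exit X u.
  by apply: exit_max => //; rewrite ?exitF ?exit_proper //; apply/uniformP/exit_uniform.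
apply/eqP; rewrite eqEsubset sub andbT.
apply: exit_max; rewrite ?exitF ?exit_proper //; first exact/uniformP/exit_uniform.
exact: (subsetP sub) (mem_exit vX).
Qed.

Lemma blockP u v : reflect (u \in exit X v /\ tr (exit X v) u = tr (exit X v) v)
  (u \in block X v).
Proof. by rewrite inE; apply: (iffP andP) => -[? /eqP]. Qed.

Lemma mem_block v : v \in X -> v \in block X v.
Proof. by move=> vX; apply/blockP; rewrite mem_exit. Qed.

Lemma block_eq u v : v \in X -> u \in block X v -> block X u = block X v.
Proof.
move=> vX /blockP[uv tuv]; rewrite /block (exit_eq vX uv).
by apply/setP=> w; rewrite !inE; congr (_ && (_ == _)).
Qed.

Lemma rep_block v : v \in X -> rep X v \in block X v.
Proof.
by move=> vX; rewrite /rep; case: pickP => [//|/(_ v)]; rewrite mem_block.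
Qed.

Lemma rep_exit v : v \in X -> rep X v \in exit X v.
Proof. by move=> /rep_block /blockP[]. Qed.

Lemma rep_mem v : v \in X -> rep X v \in X.
Proof. by move=> vX; apply: exit_sub (rep_exit vX). Qed.

Lemma rep_eq u v : v \in X -> u \in block X v -> rep X u = rep X v.
Proof.
move=> vX uv; rewrite /rep (block_eq vX uv); case: pickP => // /(_ v).
by rewrite mem_block.
Qed.

Lemma block_adj u v z : v \in X -> u \in block X v -> z \in U -> z \notin exit X v ->
  e u z = e v z.
Proof. by move=> vX /blockP[_]; apply: trace_adj. Qed.

Lemma rep_adj u v : u \in X -> v \in X -> exit X u != exit X v ->
  e u v = e (rep X u) (rep X v).
Proof.
move=> uX vX neq.
have vu : v \notin exit X u by apply: contra neq => /(exit_eq uX) ->.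
have uv : rep X u \notin exit X v.
  apply: contra neq => /(exit_eq vX) <-; apply/eqP/esym/exit_eq => //.
  exact: rep_exit.
rewrite -(block_adj uX (rep_block uX)) ?XU // sym.
by rewrite -(block_adj vX (rep_block vX)) ?XU ?rep_mem // sym.
Qed.

End Node.

Lemma exit_exit_sub (X : {set V}) (v : V) : X \in F -> 1 < #|X| -> v \in X ->
  1 < #|exit X v| -> exit (exit X v) v \subset block X v.
Proof.
move=> XF gtX vX gtY; have YF := exitF XF gtX vX; have vY := mem_exit XF gtX vX.
apply/subsetP => u uY'; apply/blockP; split; first exact: (exit_sub YF gtY vY).
by apply: (exit_uniform YF gtY vY) => //; apply: mem_exit.
Qed.

End Exits.

Arguments exitF {V e U F} lamF {X} XF gt1 {v} _.
Arguments mem_exit {V e U F} lamF {X} XF gt1 {v} _.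
Arguments exit_proper {V e U F} lamF {X} XF gt1 {v} _.
Arguments exit_sub {V e U F} lamF {X} XF gt1 {v} _.
Arguments exit_card {V e U F} lamF {X} XF gt1 {v} _.
Arguments mem_block {V e U F} lamF {X} XF gt1 {v} _.
Arguments rep_block {V e U F} lamF {X} XF gt1 {v} _.
Arguments rep_exit {V e U F} lamF {X} XF gt1 {v} _.
Arguments rep_mem {V e U F} lamF {X} XF gt1 {v} _.

Definition cograph_colorable (V : finType) (e : rel V) (c : nat) (S : {set V}) : Prop :=
  exists kappa : V -> 'I_c.+1, forall k, cograph e [set v in S | kappa v == k].

Section Quotient.

Variables (V : finType) (e : rel V) (U : {set V}) (F : {set {set V}}) (n : nat).
Hypothesis lamF : laminar_decomposition U F.
Hypothesis widthF : width_at_most e U F n.+1.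

Definition trace_index (X : {set V}) (v : V) : 'I_n.+1 :=
  inord (index (trace e U X v) (enum (traces e U X))).

Lemma trace_index_inj (X : {set V}) u v : X \in F -> u \in X -> v \in X ->
  trace_index X u = trace_index X v -> trace e U X u = trace e U X v.
Proof.
move=> XF uX vX.
have mem w : w \in X -> trace e U X w \in enum (traces e U X).
  by move=> wX; rewrite mem_enum imset_f.
have lt w : w \in X -> index (trace e U X w) (enum (traces e U X)) < n.+1.
  by move=> wX; apply: leq_trans (widthF XF); rewrite cardE index_mem mem.
move=> /(congr1 val) /=; rewrite !inordK ?lt // => E.
by rewrite -(nth_index set0 (mem u uX)) E nth_index ?mem.
Qed.

Variable X : {set V}.
Hypotheses (XF : X \in F) (gt1 : 1 < #|X|).

Local Notation ex := (exit e U F X).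
Local Notation rp := (rep e U F X).

Definition transversal_part (i j : 'I_n.+1) : {set V} :=
  [set rep e U F X v | v in [set v in X |
    (trace_index X v == i) && (trace_index (exit e U F X v) v == j)]].

Lemma transversal_part_width (i j : 'I_n.+1) : 0 < n ->
  width_at_most e (transversal_part i j)
    ([set Y :&: transversal_part i j | Y in F] :\ set0) n.
Proof.
move=> n_gt0; set S := transversal_part i j.
have SP w : w \in S -> exists2 v, v \in X & [/\ trace_index X v = i,
    trace_index (ex v) v = j & w = rp v].
  case/imsetP=> v; rewrite inE => /andP[vX /andP[/eqP iv /eqP jv]] ->.
  by exists v.
have SX : {subset S <= X} by move=> w /SP[v vX [_ _ ->]]; apply: (rep_mem lamF).
have Strace w : w \in S -> trace_index X w = i.
  case/SP=> v vX [<- _ ->]; rewrite /trace_index; congr (inord (index _ _)).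
  by apply: (exit_uniform lamF XF gt1 vX); [apply: (rep_exit lamF)|apply: (mem_exit lamF)].
move=> Z /setD1P[Z0 /imsetP[Y YF defZ]].
have small : #|Z| <= 1 -> #|traces e S Z| <= n.
  by move=> le1; apply: leq_trans (leq_imset_card _ _) (leq_trans le1 n_gt0).
have ZS : Z \subset S by rewrite defZ subsetIr.
have [XY|nXY] := boolP (X \subset Y).
  have defS : Z = S.
    rewrite defZ; apply/setIidPr/subsetP => w wS.
    exact/(subsetP XY)/SX.
  have sub : traces e S Z \subset [set set0].
    apply/subsetP => t /imsetP[u _ ->]; rewrite inE; apply/eqP/setP=> z.
    by rewrite /trace defS setDv !inE.
  by apply: leq_trans (subset_leq_card sub) _; rewrite cards1.
have YX : Y \proper X.
  rewrite properE nXY andbT; have [//|XY|dXY] := or3P (lam_nested lamF YF XF).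
    by rewrite XY in nXY.
  have /set0Pn[z] := Z0; rewrite defZ => /setIP[zY /SX zX].
  by rewrite (disjointFr dXY zY) in zX.
have [uY|nuY] := boolP (uniform e U X Y).
  apply: small; apply/card_le1_eqP => w1 w2.
  rewrite defZ => /setIP[w1Y /SP[v1 v1X [_ j1 d1]]] /setIP[w2Y /SP[v2 v2X [_ j2 d2]]].
  have ex1 : ex w1 = ex v1 by apply: (exit_eq lamF) => //; rewrite d1 (rep_exit lamF).
  have ex2 : ex w2 = ex v2 by apply: (exit_eq lamF) => //; rewrite d2 (rep_exit lamF).
  have w1X := subsetP (proper_sub YX) _ w1Y.
  have E : ex w2 = ex w1.
    apply: (exit_eq lamF) => //.
    exact: (subsetP (exit_max lamF XF gt1 YF YX uY w1Y)).
  have E' : ex v2 = ex v1 by rewrite -ex2 E ex1.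
  rewrite d1 d2.
  apply: (rep_eq lamF) => //; apply/blockP.
  have v2e : v2 \in ex v1 by rewrite -E' (mem_exit lamF).
  split=> //. apply: trace_index_inj; rewrite ?(exitF lamF) ?(mem_exit lamF) //.
  by rewrite j1 -E' j2.
have [p pY np] : exists2 p, p \in Y & trace_index X p != i.
  move: nuY; rewrite negb_forall_in => /exists_inP[u uY].
  rewrite negb_forall_in => /exists_inP[w wY neq].
  have sYX := subsetP (proper_sub YX).
  have [ui|] := eqVneq (trace_index X u) i; last by exists u.
  exists w => //; apply: contra neq => /eqP wi; apply/eqP.
  by apply: trace_index_inj; rewrite ?sYX // ui wi.
have sub : traces e S Z \subset [set t :&: S | t in traces e U Y :\ trace e U Y p].
  apply/subsetP => t /imsetP[u uZ ->].
  have uS := subsetP ZS u uZ; have uY : u \in Y by move: uZ; rewrite defZ => /setIP[].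
  apply/imsetP; exists (trace e U Y u).
    rewrite !inE imset_f // andbT; apply: contra np => /eqP E.
    rewrite -(Strace u uS) /trace_index.
    by rewrite (traceS (proper_sub YX) E).
  apply/setP=> z; rewrite !inE defZ !inE.
  case zS: (z \in S); rewrite ?andbF ?andbT //.
  by rewrite (subsetP (lam_sub lamF XF)) ?SX ?andbT.
apply: leq_trans (subset_leq_card sub) _; apply: leq_trans (leq_imset_card _ _) _.
rewrite -ltnS; apply: leq_trans (widthF YF).
by rewrite (cardsD1 (trace e U Y p) (traces e U Y)) imset_f.
Qed.

Lemma quotient_coloring c : 0 < n ->
  (forall S F', laminar_decomposition S F' -> width_at_most e S F' n ->
     cograph_colorable e c S) ->
  exists kappa : V -> 'I_n.+1 * 'I_n.+1 * 'I_c.+1,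
  [/\ forall k, cograph e [set rep e U F X v | v in [set v in X | kappa v == k]],
      forall u v, v \in X -> u \in block e U F X v -> kappa u = kappa v
    & forall u v, v \in X -> u \in exit e U F X v -> kappa u = kappa v ->
        u \in block e U F X v].
Proof.
move=> n_gt0 IH.
have [k0 k0P] : exists k0 : 'I_n.+1 * 'I_n.+1 -> V -> 'I_c.+1, forall ij k,
    cograph e [set v in transversal_part ij.1 ij.2 | k0 ij v == k].
  apply: (@fin_all_exists _ (fun=> V -> 'I_c.+1)
    (fun ij k0 => forall k, cograph e [set v in transversal_part ij.1 ij.2 | k0 v == k])).
  move=> [i j] /=; have [S0|S0] := eqVneq (transversal_part i j) set0.
    exists (fun=> ord0) => k; have -> : [set v in transversal_part i j | ord0 == k] = set0.
      by rewrite S0; apply/setP=> v; rewrite !inE.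
    exact: cograph0.
  have lamS : laminar_decomposition (transversal_part i j)
      ([set Y :&: transversal_part i j | Y in F] :\ set0); last first.
    have [k1 k1P] := IH _ _ lamS (transversal_part_width n_gt0).
    by exists k1.
  apply: (laminar_restrict lamF) => //; apply/subsetP => _ /imsetP[v vX ->].
  apply: (subsetP (lam_sub lamF XF)); apply: (rep_mem lamF) => //.
  by move: vX; rewrite inE => /andP[].
exists (fun v => (trace_index X v, trace_index (ex v) v,
   k0 (trace_index X v, trace_index (ex v) v) (rp v))); split.
- move=> [[i j] l]; apply: cographS (k0P (i, j) l) _.
  apply/subsetP => _ /imsetP[v vX ->]; move: vX.
  rewrite inE => /andP[vX /eqP[iv jv lv]].
  rewrite inE -lv iv jv eqxx andbT; apply/imsetP; exists v => //.
  by rewrite inE vX iv jv !eqxx.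
- move=> u v vX uv; have uE : u \in ex v by case/blockP: uv.
  have Ee : ex u = ex v by apply: (exit_eq lamF).
  have Er : rp u = rp v by apply: (rep_eq lamF).
  have Et : trace_index X u = trace_index X v.
    rewrite /trace_index (exit_uniform lamF XF gt1 vX uE (mem_exit lamF XF gt1 vX)) //.
  have Et' : trace_index (ex v) u = trace_index (ex v) v.
    by rewrite /trace_index; case/blockP: uv => _ ->.
  by rewrite Ee Er Et Et'.
move=> u v vX uv [_ E _]; apply/blockP; split=> //.
have Ee : ex u = ex v by apply: (exit_eq lamF).
apply: trace_index_inj; rewrite ?(exitF lamF) ?(mem_exit lamF) //.
by rewrite Ee in E.
Qed.

End Quotient.

(** * Words along exits *)

Section Compression.

Variable K : eqType.

Definition is_inr (l : K + bool) : bool := if l is inr _ then true else false.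

Definition starts (l : K + bool) (w : seq ((K + bool) * bool)) : bool :=
  if w is (m, _) :: _ then m == l else false.

Definition push (l : K + bool) (w : seq ((K + bool) * bool)) : seq ((K + bool) * bool) :=
  if w is (m, p) :: w' then
    if is_inr l && (m == l) then (l, ~~ p) :: w' else (l, false) :: w
  else [:: (l, false)].

Lemma push_inv l w m p r : push l w = (m, p) :: r ->
  m = l /\ (p = false /\ w = r /\ ~~ (is_inr l && starts l r)
            \/ is_inr l /\ w = (l, ~~ p) :: r).
Proof.
case: w => [|[m' p'] w] /=; first by case=> <- <- <-; split=> //; left; rewrite andbF.
case: ifP => [/andP[il /eqP ->]|nil] [<- <- <-]; split=> //.
  by right; rewrite negbK.
by left; rewrite /= nil.
Qed.

Lemma size_push l w : size (push l w) <= (size w).+1.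
Proof. by case: w => [|[m p] w] //=; case: ifP. Qed.

End Compression.

Section Words.

Variables (V : finType) (e : rel V) (U : {set V}) (F : {set {set V}}).
Hypothesis lamF : laminar_decomposition U F.
Hypothesis sym : symmetric e.

Local Notation exit := (exit e U F).
Local Notation block := (block e U F).
Local Notation rep := (rep e U F).

Variables (K : finType) (kappa : {set V} -> V -> K).
Hypothesis kappa_cograph : forall X k, X \in F -> 1 < #|X| ->
  cograph e [set rep X v | v in [set v in X | kappa X v == k]].
Hypothesis kappa_block : forall X u v, X \in F -> 1 < #|X| -> v \in X ->
  u \in block X v -> kappa X u = kappa X v.
Hypothesis kappa_exit : forall X u v, X \in F -> 1 < #|X| -> v \in X ->
  u \in exit X v -> kappa X u = kappa X v -> u \in block X v.

Definition letter (X : {set V}) (v : V) : K + bool :=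
  if [forall z in X :\: exit X v, ~~ e v z] then inr false
  else if [forall z in X :\: exit X v, e v z] then inr true
  else inl (kappa X v).

Fixpoint fueled_word (n : nat) (X : {set V}) (v : V) : seq ((K + bool) * bool) :=
  if n is n'.+1 then
    if 1 < #|X| then push (letter X v) (fueled_word n' (exit X v) v) else [::]
  else [::].

Definition word (X : {set V}) (v : V) := fueled_word #|X| X v.

Lemma fueled_wordE n m (X : {set V}) v : X \in F -> v \in X ->
  #|X| <= n -> #|X| <= m -> fueled_word n X v = fueled_word m X v.
Proof.
elim: n m X => [|n IH] [|m] X XF vX //= len lem.
- by case: leqP => // gt1; move: (leq_trans gt1 len).
- by case: leqP => // gt1; move: (leq_trans gt1 lem).
case: leqP => // gt1; congr push.
have lt := exit_card (e := e) lamF XF gt1 vX.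
apply: IH; rewrite ?(exitF lamF) ?(mem_exit lamF) //.
  by rewrite -ltnS (leq_trans lt).
by rewrite -ltnS (leq_trans lt).
Qed.

Lemma wordE (X : {set V}) v : X \in F -> v \in X -> 1 < #|X| ->
  word X v = push (letter X v) (word (exit X v) v).
Proof.
move=> XF vX gt1; rewrite {1}/word.
case defn: #|X| gt1 => [|n] // gt1; rewrite /= defn gt1; rewrite -defn in gt1.
congr push; apply: fueled_wordE; rewrite ?(exitF lamF) ?(mem_exit lamF) //.
by rewrite -ltnS -defn (exit_card lamF).
Qed.

Lemma word_small (X : {set V}) v : #|X| <= 1 -> word X v = [::].
Proof. by rewrite /word; case defn: #|X| => [|[|n]] //= _; rewrite defn. Qed.

Section Node.

Variable X : {set V}.
Hypotheses (XF : X \in F) (gt1 : 1 < #|X|).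

Let XU : {subset X <= U}.
Proof. by apply/subsetP/(lam_sub lamF). Qed.

Lemma letter_block u v : v \in X -> u \in block X v -> letter X u = letter X v.
Proof.
move=> vX uv; have uE : u \in exit X v by case/blockP: uv.
rewrite /letter (exit_eq lamF XF gt1 vX uE) (kappa_block XF gt1 vX uv).
have E z : z \in X :\: exit X v -> e u z = e v z.
  by case/setDP=> zX zE; apply: (block_adj vX uv) => //; apply: XU.
have -> : [forall z in X :\: exit X v, ~~ e u z] = [forall z in X :\: exit X v, ~~ e v z].
  by apply/eq_forallb_in => z zD; rewrite E.
have -> : [forall z in X :\: exit X v, e u z] = [forall z in X :\: exit X v, e v z].
  by apply/eq_forallb_in => z zD; rewrite E.
by [].
Qed.

Lemma letter_inr b v z : letter X v = inr b -> z \in X -> z \notin exit X v -> e v z = b.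
Proof.
rewrite /letter => + zX zE; have zD : z \in X :\: exit X v by rewrite inE zE.
case: forall_inP => [H [<-]|_]; first by rewrite (negbTE (H z zD)).
by case: forall_inP => [H [<-]|_ //]; rewrite (H z zD).
Qed.

Lemma letter_inl k v : letter X v = inl k -> kappa X v = k.
Proof. by rewrite /letter; do 2!case: ifP => // _; case. Qed.

Lemma letter_witness b v : v \in X -> letter X v != inr (~~ b) ->
  exists z, [/\ z \in X, z \notin exit X v & e v z = b].
Proof.
move=> vX; have D0 : exists2 z, z \in X & z \notin exit X v.
  by have /properP[_ [z]] := exit_proper (e := e) lamF XF gt1 vX; exists z.
rewrite /letter; case: ifPn => [/forall_inP H|/forall_inPn[z zD nz]].
  case: b => //= _; have [z zX zE] := D0; exists z; split=> //.
  by apply/negbTE/H; rewrite inE zE.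
rewrite negbK in nz; case: ifPn => [/forall_inP H|/forall_inPn[y yD ny]].
  case: b => //= _; have [y yX yE] := D0; exists y; split=> //.
  by apply: H; rewrite inE yE.
move=> _; case/setDP: zD => zX zE; case/setDP: yD => yX yE.
by case: b; [exists z | exists y; split=> //; apply: negbTE].
Qed.

End Node.

Definition word_class (X : {set V}) w : {set V} := [set v in X | word X v == w].

(* Both sets sit at the end of an [inr b]-run, of lengths differing by a
   positive even number, so that an element of the second one still carries the
   letter [inr b] at the next node, where two blocks of one exit separate. *)
Lemma word_class_homogeneous (X : {set V}) b r : X \in F -> ~~ starts (inr b) r ->
  homogeneous e b (word_class X ((inr b, true) :: r)) (word_class X r).
Proof.
move=> XF nr u v; rewrite !inE => /andP[uX /eqP wu] /andP[vX /eqP wv].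
have gt1 : 1 < #|X| by rewrite ltnNge; apply: contraPN wu => /word_small ->.
move: wu; rewrite wordE // => /push_inv [lu [[//]|[_ wu]]].
have [vE|vE] := boolP (v \in exit X u); last by apply: letter_inr vX vE.
set Y := exit X u in vE wu.
have YF : Y \in F by rewrite (exitF lamF).
have uY : u \in Y by rewrite (mem_exit lamF).
have gtY : 1 < #|Y| by rewrite ltnNge; apply: contraPN wu => /word_small ->.
move: wu; rewrite wordE // => /push_inv [lYu _].
apply: (letter_inr (X := Y)) (vE) _; first by rewrite -lYu.
apply/negP => vY'.
have vB : v \in block X u.
  apply/blockP; split=> //. apply: (exit_uniform lamF YF gtY uY) => //.
  exact: (mem_exit lamF).
move: wv; rewrite wordE // (letter_block XF gt1 uX vB) -lu => wv.
case: r nr wv => [|[m p] r] /= nr.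
  by case: (word _ v) => [|[m p] w] //=; case: ifP.
by case/push_inv=> Em; rewrite Em eqxx in nr.
Qed.

Lemma cograph_word_class (X : {set V}) w : X \in F -> cograph e (word_class X w).
Proof.
move: {2}#|X| (leqnn #|X|) => n; elim: n X w => [|n IH] X w leX XF.
  by move: leX; rewrite leqn0 cards_eq0 (negbTE (lam_neq0 lamF XF)).
have [le1|gt1] := leqP #|X| 1.
  have /set0Pn[x xX] := lam_neq0 lamF XF.
  apply: cographS (cograph1 e x) _; apply/subsetP => y /setIdP[yX _].
  by rewrite inE; apply/eqP; apply: (card_le1_eqP le1).
have IHexit v r : v \in X -> cograph e (word_class (exit X v) r).
  move=> vX; apply: IH; last exact: (exitF lamF).
  by rewrite -ltnS (leq_trans (exit_card lamF XF gt1 vX)).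
have const b (A : {set V}) : A \subset [set v in X | letter X v == inr b] ->
    (forall v, v \in A -> cograph e (A :&: exit X v)) -> cograph e A.
  move=> sA cA.
  apply: (@cograph_substitution _ _ e (fun _ _ => b) (exit X) setT A).
  - exact: (@cograph_constant _ _ b).
  - by [].
  - move=> u v /(subsetP sA); rewrite inE => /andP[uX /eqP lu] /(subsetP sA).
    rewrite inE => /andP[vX _] neq; apply: letter_inr lu vX _.
    by apply: contra neq => /(exit_eq lamF XF gt1 uX) ->.
  move=> Y _; have [->|[v]] := set_0Vmem [set x in A | exit X x == Y]; first exact: cograph0.
  rewrite inE => /andP[vA /eqP <-]; apply: cographS (cA v vA) _.
  apply/subsetP => u; rewrite !inE => /andP[uA /eqP <-]; rewrite uA /=.
  by apply: (mem_exit lamF) => //; have := subsetP sA u uA; rewrite inE => /andP[].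
case: w => [|[[k|b] p] r].
- have -> : word_class X [::] = set0; last exact: cograph0.
  apply/setP=> v; rewrite !inE; apply/negP => /andP[vX].
  rewrite wordE //; case: (word _ v) => [|[m p] w] //=.
  by case: ifP.
- apply: (@cograph_substitution _ _ e e (rep X)) (kappa_cograph k XF gt1) _ _ _.
  + move=> v; rewrite inE => /andP[vX]; rewrite wordE // => /eqP/push_inv[lv _].
    apply: imset_f; rewrite inE vX; apply/eqP; apply: letter_inl.
    exact: esym.
  + move=> u v; rewrite !inE => /andP[uX] + /andP[vX].
    rewrite wordE // [word X v]wordE // => /eqP/push_inv[lu _] /eqP/push_inv[lv _] neq.
    apply: (rep_adj lamF) => //; apply: contra neq => /eqP E.
    apply/eqP; apply: (rep_eq lamF) => //; apply: kappa_exit => //.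
      by rewrite -E (mem_exit lamF).
    by rewrite (letter_inl (esym lu)) (letter_inl (esym lv)).
  move=> _ /imsetP[v vX ->]; have {}vX : v \in X by move: vX; rewrite inE => /andP[].
  apply: cographS (IHexit v r vX) _; apply/subsetP => u.
  rewrite !inE => /andP[/andP[uX wu] /eqP E].
  have Ee : exit X u = exit X v.
    rewrite -(exit_eq lamF XF gt1 uX (rep_exit lamF XF gt1 uX)) E.
    exact: (exit_eq lamF XF gt1 vX (rep_exit lamF XF gt1 vX)).
  rewrite -Ee (mem_exit lamF) //=.
  by move: wu; rewrite wordE // => /eqP/push_inv[<- [[_ [-> _]]|[]]].
apply: (const b) => [|v].
  apply/subsetP => v; rewrite !inE => /andP[vX]; rewrite vX wordE //.
  by move=> /eqP/push_inv[<- _]; rewrite eqxx.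
rewrite inE => /andP[vX _].
have [pt|/norP[/negbTE p0 nr]] := boolP (p || starts (inr b) r).
  apply: cographS (IHexit v ((inr b, ~~ p) :: r) vX) _; apply/subsetP => u.
  rewrite !inE => /andP[/andP[uX wu] uE]; rewrite uE /=.
  move: wu; rewrite wordE // => /eqP/push_inv[<- ].
  rewrite (exit_eq lamF XF gt1 vX uE) => -[[p0 [_ /negP[]]]|[_ ->] //].
  by rewrite /=; move: pt; rewrite p0.
subst p; have vE := mem_exit lamF XF gt1 vX.
have YF := exitF (e := e) lamF XF gt1 vX.
apply: (@cographS _ _ _ (word_class (exit X v) ((inr b, true) :: r)
                         :|: word_class (exit X v) r)).
  apply: (@cographU _ _ b); try exact: IHexit.
    rewrite -setI_eq0; apply/eqP/setP=> u; rewrite !inE.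
    apply/negP => /andP[/andP[_ /eqP ->] /andP[_ /eqP E]].
    by have /(congr1 size)/eqP := E; rewrite /= eqn_leq ltnn.
  exact: word_class_homogeneous.
apply/subsetP => u; rewrite !inE => /andP[/andP[uX wu] uE]; rewrite uE /=.
move: wu; rewrite wordE // => /eqP/push_inv[<-].
rewrite (exit_eq lamF XF gt1 vX uE) => -[[_ [-> _]]|[_ ->]].
  by rewrite eqxx orbT.
by rewrite /= eqxx.
Qed.

End Words.

(** * Half-graphs from long words *)

Fixpoint ladder (V : finType) (e : rel V) (n : nat) (S : {set V}) : Prop :=
  if n is n'.+1 then exists (a b : V) (S' : {set V}),
    [/\ a \in S, b \in S, S' \subset S & a \notin S']
    /\ [/\ b \notin S', {in S', forall z, e a z}, {in S', forall z, ~~ e b z}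
         & ladder e n' S']
  else True.

Lemma ladderS (V : finType) (e : rel V) n (S S' : {set V}) :
  S' \subset S -> ladder e n S' -> ladder e n S.
Proof.
case: n => //= n sS [a [b [R [[aS bS RS aR] H]]]]; exists a, b, R; split=> //.
by split=> //; [apply: (subsetP sS) | apply: (subsetP sS) | apply: subset_trans sS].
Qed.

Lemma ladder_seq (V : finType) (e : rel V) n (x0 : V) (A : {set V}) :
  ladder e n A -> exists a b : nat -> V,
    (forall i, i < n -> a i \in A /\ b i \in A) /\
    (forall i j, i < j -> j < n ->
      [/\ a i != b j, b i != a j, e (a i) (b j) & ~~ e (b i) (a j)]).
Proof.
elim: n A => [|n IH] A; first by exists (fun=> x0), (fun=> x0).
case=> a0 [b0 [S [[aA bA SA aS] [bS ea eb]]]] /IH [a [b [memS H]]].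
exists (fun i => if i is j.+1 then a j else a0), (fun i => if i is j.+1 then b j else b0).
split=> [[|i] //= lt|[|i] [|j] //= ij jn]; last exact: H.
  by have [aiS biS] := memS i lt; split; apply: (subsetP SA).
have [ajS bjS] := memS j jn; split; rewrite ?ea ?eb //.
- by apply: contraNneq aS => ->.
by apply: contraNneq bS => ->.
Qed.

Lemma semi_induced_half_graph (G : sgraph) (t : nat) (a b : 'I_t -> G) :
  (forall i j, a i != b j) -> (forall i j, adj (a i) (b j) = (i <= j)) ->
  semi_induced_subgraph (half_graph t) G.
Proof.
move=> neq ab; pose X := [set a i | i : 'I_t]; pose Y := [set b j | j : 'I_t].
have aX i : a i \in X by apply: imset_f.
have bY i : b i \in Y by apply: imset_f.
have aY i : a i \in Y = false.
  by apply/imsetP => -[j _ E]; have := neq i j; rewrite E eqxx.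
have bX j : b j \in X = false.
  by apply/imsetP => -[i _ E]; have := neq i j; rewrite E eqxx.
have inja : injective a.
  move=> i i' E; apply/val_inj/eqP; rewrite eqn_leq.
  by rewrite -(ab i i') E ab leqnn -(ab i' i) -E ab leqnn.
have injb : injective b.
  move=> j j' E; apply/val_inj/eqP; rewrite eqn_leq.
  by rewrite -(ab j j') -E ab leqnn -(ab j' j) E ab leqnn.
exists X, Y; split.
  rewrite -setI_eq0; apply/eqP/setP=> x; rewrite inE [in RHS]inE.
  by apply/negP => /andP[/imsetP[i _ ->]]; rewrite aY.
have mem (u : 'I_t + 'I_t) : (match u with inl i => a i | inr j => b j end) \in X :|: Y.
  by case: u => i; rewrite inE ?aX ?bY ?orbT.
pose f (u : half_graph t) : between X Y := exist (fun x => x \in X :|: Y) _ (mem u).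
have injf : injective f.
  move=> u v /(congr1 val) /=; case: u v => [i|i] [j|j] //=.
  - by move/inja=> ->.
  - by move=> E; have := neq i j; rewrite E eqxx.
  - by move=> E; have := neq j i; rewrite E eqxx.
  by move/injb=> ->.
exists f.
  apply: inj_card_bij => //.
  have -> : #|between X Y| = #|X :|: Y| by rewrite card_sig; apply: eq_card.
  have -> : #|half_graph t| = #|'I_t| + #|'I_t| by rewrite card_sum.
  by apply: leq_trans (leq_card_setU X Y).1 _; apply: leq_add; apply: leq_imset_card.
move=> [i|i] [j|j]; rewrite /= /between_adj /= ?aX ?aY ?bX ?bY ?andbF ?andbT ?orbF //.
by rewrite adj_sym ab.
Qed.

Lemma ladder_half_graph (G : sgraph) (t : nat) (S : {set G}) :
  ladder (@adj G) t.*2 S -> semi_induced_subgraph (half_graph t) G.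
Proof.
case: t => [_|t lad].
  have z : 'I_0 -> G by case.
  by apply: (@semi_induced_half_graph _ _ z z); case.
have [x0 _] := lad; have {lad} [a [b [_ H]]] := ladder_seq x0 lad.
move: t.+1 H => {}t H.
have lt1 (i : 'I_t) : i.*2 < t.*2 by rewrite ltn_double.
have lt2 (i : 'I_t) : i.*2.+1 < t.*2 by rewrite ltn_Sdouble.
have up (i j : 'I_t) : i <= j -> i.*2 < j.*2.+1 by rewrite ltnS leq_double.
have down (i j : 'I_t) : j < i -> j.*2.+1 < i.*2 by rewrite ltn_Sdouble.
apply: (@semi_induced_half_graph _ _ (fun i => a i.*2) (fun j => b j.*2.+1)) => i j.
  have [ij|ji] := leqP i j.
    by case: (H _ _ (up _ _ ij) (lt2 j)).
  by case: (H _ _ (down _ _ ji) (lt1 i)) => _ neq _ _; rewrite eq_sym.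
have [ij|ji] := leqP i j.
  by case: (H _ _ (up _ _ ij) (lt2 j)).
by case: (H _ _ (down _ _ ji) (lt1 i)) => _ _ _ /negbTE; rewrite adj_sym.
Qed.

Section WordLength.

Variables (V : finType) (e : rel V) (U : {set V}) (F : {set {set V}}).
Hypothesis lamF : laminar_decomposition U F.
Hypothesis sym : symmetric e.
Variables (K : finType) (kappa : {set V} -> V -> K).

Local Notation exit := (exit e U F).
Local Notation word := (word e U F kappa).
Local Notation letter := (letter e U F kappa).

Lemma word_gt1 (X : {set V}) v : 0 < size (word X v) -> 1 < #|X|.
Proof. by rewrite ltnNge [1 < _]ltnNge; apply: contra => /word_small ->. Qed.

Lemma size_wordE (X : {set V}) v : X \in F -> v \in X -> 1 < #|X| ->
  size (word X v) <= (size (word (exit X v) v)).+1.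
Proof. by move=> XF vX gt1; rewrite wordE // size_push. Qed.

Definition rung_below (b : bool) (X : {set V}) (v : V) (d : nat) : Prop :=
  exists z X', [/\ z \in X, X' \in F, v \in X' & X' \subset X] /\
    [/\ z \notin X', {in X', forall y, e z y = b}
      & size (word X v) <= d + size (word X' v)].

Lemma rung_at_letter b (X : {set V}) v : X \in F -> v \in X ->
  1 < size (word X v) -> letter X v != inr (~~ b) -> rung_below b X v 2.
Proof.
move=> XF vX szX lX; have gtX := word_gt1 (ltnW szX).
have [z [zX zE ez]] := letter_witness lamF XF gtX vX lX.
have leX := size_wordE XF vX gtX; have szY := leq_trans szX leX.
have gtY : 1 < #|exit X v| by apply: (@word_gt1 _ v).
have YF := exitF (e := e) lamF XF gtX vX; have vY := mem_exit (e := e) lamF XF gtX vX.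
have sub := exit_exit_sub lamF XF gtX vX gtY.
exists z, (exit (exit X v) v); split; split.
- by [].
- exact: exitF.
- exact: mem_exit.
- apply: subset_trans (proper_sub (exit_proper lamF YF gtY vY)) _.
  exact: proper_sub (exit_proper lamF XF gtX vX).
- by apply: contra zE; apply: (subsetP (proper_sub (exit_proper lamF YF gtY vY))).
- move=> y /(subsetP sub) yB; rewrite sym (block_adj vX yB) //.
  exact: (subsetP (lam_sub lamF XF)).
by apply: leq_trans leX _; rewrite ltnS size_wordE.
Qed.

Lemma rung_exists b (X : {set V}) v : X \in F -> v \in X ->
  2 < size (word X v) -> rung_below b X v 3.
Proof.
move: {2}#|X| (leqnn #|X|) => n; elim: n X => [|n IH] X leX XF vX szX.
  by move: leX; rewrite leqn0 cards_eq0 (negbTE (lam_neq0 lamF XF)).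
have [lX|lX] := eqVneq (letter X v) (inr (~~ b)); last first.
  have [z [X' [H1 [H2 H3 H4]]]] := rung_at_letter XF vX (ltnW szX) lX.
  by exists z, X'; split=> //; split=> //; rewrite addSn leqW.
have gtX := word_gt1 (ltnW (ltnW szX)).
have YF := exitF (e := e) lamF XF gtX vX; have vY := mem_exit (e := e) lamF XF gtX vX.
have leXY := size_wordE XF vX gtX; have szY := leq_trans szX leXY.
have YX := exit_sub (e := e) lamF XF gtX vX.
have sYX : exit X v \subset X by apply/subsetP.
have lift d : rung_below b (exit X v) v d ->
    size (word X v) + d <= 3 + size (word (exit X v) v) -> rung_below b X v 3.
  case=> z [X' [[H1 H2 H3 H4] [H5 H6 H7]]] le; exists z, X'; split; split=> //.
  - exact: YX.
  - exact: subset_trans sYX.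
  rewrite -(leq_add2r d) (leq_trans le) // -addnA leq_add2l addnC.
  exact: H7.
have [lY|lY] := eqVneq (letter (exit X v) v) (inr (~~ b)); last first.
  by apply: (lift 2); [apply: rung_at_letter | rewrite addn2 !addSn !ltnS].
have gtY : 1 < #|exit X v| by apply: (@word_gt1 _ v); apply: ltnW.
have same : size (word X v) = size (word (exit X v) v).
  rewrite wordE // lX wordE // lY.
  case: (word _ v) => [|[m p] w] /=; first by rewrite eqxx.
  by case: ifP => _ /=; rewrite ?eqxx.
apply: (lift 3); last by rewrite same addnC.
apply: IH => //; last by rewrite -same.
by rewrite -ltnS (leq_trans (exit_card lamF XF gtX vX)).
Qed.

Lemma word_ladder n (X : {set V}) v : X \in F -> v \in X ->
  6 * n <= size (word X v) -> ladder e n X.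
Proof.
elim: n X => [//|n IH] X XF vX; rewrite mulnS => szX.
have [|a [X1 [[aX X1F vX1 X1X] [aX1 ea sz1]]]] := @rung_exists true X v XF vX.
  by apply: leq_trans szX.
have sz1' : 3 + 6 * n <= size (word X1 v).
  by rewrite -(leq_add2l 3) (leq_trans szX).
have [|b [X2 [[bX X2F vX2 X21] [bX2 eb sz2]]]] := @rung_exists false X1 v X1F vX1.
  by apply: leq_trans sz1'.
exists a, b, X2; split; split=> //.
- exact: (subsetP X1X).
- exact: subset_trans X1X.
- by apply: contra aX1; apply: (subsetP X21).
- by move=> z /(subsetP X21)/ea.
- by move=> z /eb ->.
by apply: (IH X2) => //; rewrite -(leq_add2l 3) (leq_trans sz1').
Qed.

End WordLength.

Lemma bounded_width_colorable m n : exists c, forall (V : finType) (e : rel V)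
    (U : {set V}) (F : {set {set V}}), symmetric e -> ~ ladder e m [set: V] ->
  laminar_decomposition U F -> width_at_most e U F n.+1 -> cograph_colorable e c U.
Proof.
elim: n => [|n [c IH]].
  exists 0 => V e U F sym _ lamF w1; exists (fun=> ord0) => k.
  apply: cographS (width1_cograph lamF w1 sym) _.
  by apply/subsetP => v; rewrite inE => /andP[].
pose K : finType := ('I_n.+2 * 'I_n.+2 * 'I_c.+1)%type.
pose W : finType := {bseq (6 * m) of (K + bool) * bool}.
exists #|W| => V e U F sym nlad lamF wF.
have [kappa kappaP] : exists kappa : {set V} -> V -> K, forall X,
    X \in F -> 1 < #|X| ->
    [/\ forall k, cograph e [set rep e U F X v | v in [set v in X | kappa X v == k]],
      forall u v, v \in X -> u \in block e U F X v -> kappa X u = kappa X v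
    & forall u v, v \in X -> u \in exit e U F X v -> kappa X u = kappa X v ->
        u \in block e U F X v].
  apply: (@fin_all_exists _ (fun=> V -> K) (fun X kappa => X \in F -> 1 < #|X| ->
    [/\ forall k, cograph e [set rep e U F X v | v in [set v in X | kappa v == k]],
      forall u v, v \in X -> u \in block e U F X v -> kappa u = kappa v
    & forall u v, v \in X -> u \in exit e U F X v -> kappa u = kappa v ->
        u \in block e U F X v])) => X.
  have [XF|nXF] := boolP (X \in F); last by exists (fun=> (ord0, ord0, ord0)).
  have [le1|gt1] := leqP #|X| 1; first by exists (fun=> (ord0, ord0, ord0)).
  have [//||kappa H] := quotient_coloring lamF wF XF gt1 (c := c).
    by move=> S F' lamS wS; apply: IH lamS wS.
  by exists kappa.
have UF := lam_top lamF.
have lenW v : v \in U -> size (word e U F kappa U v) <= 6 * m.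
  move=> vU; rewrite leqNgt; apply/negP => /ltnW lt; apply: nlad.
  apply: ladderS (subsetT U) _.
  exact: (@word_ladder V e U F lamF sym K kappa m U v UF vU lt).
pose code v : W := insubd [bseq] (word e U F kappa U v).
exists (fun v => widen_ord (leqnSn _) (enum_rank (code v))) => k.
have [->|[v]] := set_0Vmem [set v in U | widen_ord (leqnSn _) (enum_rank (code v)) == k].
  exact: cograph0.
rewrite inE => /andP[vU /eqP <-].
have cogw : cograph e (word_class e U F kappa U (word e U F kappa U v)).
  apply: (cograph_word_class lamF sym) UF.
  - by move=> X k' XF gt1; case: (kappaP X XF gt1).
  - by move=> X u w XF gt1; case: (kappaP X XF gt1) => _ H _; apply: H.
  by move=> X u w XF gt1; case: (kappaP X XF gt1) => _ _; apply.
apply: cographS cogw _; apply/subsetP => u; rewrite !inE => /andP[uU /eqP E].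
rewrite uU; apply/eqP.
have /enum_rank_inj/(congr1 val) : enum_rank (code u) = enum_rank (code v).
  by apply: val_inj; have /(congr1 val) := E.
by rewrite !val_insubd !lenW.
Qed.

(** * From rank decompositions to laminar families *)

Lemma laminar_join (V : finType) (U1 U2 : {set V}) (F1 F2 : {set {set V}}) :
  laminar_decomposition U1 F1 -> laminar_decomposition U2 F2 -> [disjoint U1 & U2] ->
  laminar_decomposition (U1 :|: U2) ((U1 :|: U2) |: (F1 :|: F2)).
Proof.
move=> lam1 lam2 dU; set U := U1 :|: U2.
have sub X : X \in U |: (F1 :|: F2) -> X \subset U.
  case/setU1P=> [-> //|/setUP[/(lam_sub lam1)|/(lam_sub lam2)] H].
    exact: subset_trans H (subsetUl _ _).
  exact: subset_trans H (subsetUr _ _).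
have dF X Y : X \in F1 -> Y \in F2 -> [disjoint X & Y].
  move=> /(lam_sub lam1) XU /(lam_sub lam2) YU.
  by apply: disjointWl XU _; apply: disjointWr YU _.
split=> //.
- move=> X /setU1P[->|/setUP[/(lam_neq0 lam1)|/(lam_neq0 lam2)] //].
  by rewrite setU_eq0 negb_and (lam_neq0 lam1 (lam_top lam1)).
- move=> X Y XF YF; have XU := sub X XF; have YU := sub Y YF.
  case/setU1P: XF => [->|XF]; first by rewrite YU orbT.
  case/setU1P: YF => [->|YF]; first by rewrite XU.
  case/setUP: XF => XF; case/setUP: YF => YF.
  + exact: lam_nested lam1 _ _ XF YF.
  + by rewrite dF ?orbT.
  + by rewrite disjoint_sym dF ?orbT.
  + exact: lam_nested lam2 _ _ XF YF.
- exact: setU11.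
- move=> x /setUP[] xU; apply: setU1r; rewrite inE.
    by rewrite (lam_set1 lam1).
  by rewrite (lam_set1 lam2) ?orbT.
move=> X /setU1P[-> _|/setUP[] XF gt1].
- exists U1, U2; split=> //; apply: setU1r; rewrite inE.
    by rewrite (lam_top lam1).
  by rewrite (lam_top lam2) orbT.
- have [Y [Z [YF ZF E d]]] := lam_split lam1 XF gt1.
  by exists Y, Z; split=> //; apply: setU1r; rewrite inE ?YF ?ZF.
have [Y [Z [YF ZF E d]]] := lam_split lam2 XF gt1.
by exists Y, Z; split=> //; apply: setU1r; rewrite inE ?YF ?ZF orbT.
Qed.

Lemma laminar_set1 (V : finType) (v : V) : laminar_decomposition [set v] [set [set v]].
Proof.
split.
- by move=> X /set1P ->.
- by move=> X /set1P ->; apply/set0Pn; exists v; rewrite inE.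
- by move=> X Y /set1P -> /set1P ->; rewrite subxx.
- exact: set11.
- by move=> x /set1P ->; rewrite inE.
by move=> X /set1P ->; rewrite cards1.
Qed.

Lemma connect_closed_set (T : finType) (r : rel T) (S : {set T}) x u :
  connect r x u -> x \in S -> (forall a b, a \in S -> r a b -> b \in S) -> u \in S.
Proof.
move=> /connectP[p rp ->] xS cl; elim: p x rp xS => //= y p IH x /andP[xy rp] xS.
exact: IH rp (cl _ _ xS xy).
Qed.

Section TreeSides.

Variable T : sgraph.
Hypothesis treeT : is_tree T.

Definition side (x y : T) : {set T} := [set u | connect (adj_minus_edge x y) x u].

Definition avoid (x : T) : rel T := fun u v => [&& adj u v, u != x & v != x].

Lemma minus_sym (x y : T) : symmetric (adj_minus_edge x y).
Proof. by move=> u v; rewrite /adj_minus_edge adj_sym setUC. Qed.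

Lemma adj_neq (x y : T) : adj x y -> x != y.
Proof. by apply: contraTneq => ->; rewrite adj_irrefl. Qed.

Lemma mem_side (x y : T) : x \in side x y.
Proof. by rewrite inE. Qed.

Lemma side_step (x y u v : T) : u \in side x y -> adj_minus_edge x y u v -> v \in side x y.
Proof. by rewrite !inE => xu uv; apply: connect_trans xu (connect1 uv). Qed.

Lemma bridge (x y : T) : adj x y -> y \notin side x y.
Proof.
move=> xy; rewrite inE; apply/negP => /connectP[p0 p0P].
case/shortenP: p0P => p pP up _ {p0} Ey.
have [_ _ acyc] := treeT.
have padj : path (@adj T) x p by apply: sub_path pP => u v /andP[].
have ucp : ucycle (@adj T) (x :: p).
  by rewrite /ucycle up andbT /= rcons_path padj -Ey adj_sym xy.
move: (acyc _ ucp); case: p pP Ey {up padj ucp} => [|z [|//]] /=.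
  by move=> _ E; rewrite -E adj_irrefl in xy.
by rewrite andbT /adj_minus_edge => + E; rewrite -E eqxx andbF.
Qed.

Lemma avoid_minus (x y u v : T) : avoid x u v -> adj_minus_edge x y u v.
Proof.
case/and3P=> uv ux vx; rewrite /adj_minus_edge uv; apply/eqP => /setP/(_ x).
by rewrite !inE eqxx eq_sym (negbTE ux) eq_sym (negbTE vx).
Qed.

Lemma minusC (x y : T) : adj_minus_edge x y =2 adj_minus_edge y x.
Proof. by move=> u v; rewrite /adj_minus_edge [[set x; y]]setUC. Qed.

Lemma side_avoid (w x u : T) : adj w x -> (u \in side w x) = connect (avoid x) w u.
Proof.
move=> wx; apply/idP/idP => [|wu].
  rewrite inE => /connect_closed_set.
  move=> /(_ [set a in side w x | connect (avoid x) w a]).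
  rewrite [w \in _]inE mem_side connect0 => /(_ isT) cl.
  suff : u \in [set a in side w x | connect (avoid x) w a] by rewrite inE => /andP[].
  apply: cl => a b; rewrite [a \in _]inE => /andP[aS wa] ab.
  have bS := side_step aS ab; rewrite inE bS /=.
  apply: connect_trans wa (connect1 _); rewrite /avoid.
  have [-> _] := andP ab; rewrite /=.
  by apply/andP; split; [apply: contraTneq aS|apply: contraTneq bS] => ->; apply: bridge.
rewrite inE (eq_connect (minusC w x)).
by apply: connect_sub wu => a b /(avoid_minus w) ab; apply: connect1.
Qed.

Lemma sideU (x y : T) : adj x y ->
  side x y = x |: \bigcup_(w in [set w | adj x w] :\ y) side w x.
Proof.
move=> xy; apply/eqP; rewrite eqEsubset; apply/andP; split; apply/subsetP => u.
  rewrite inE => /connect_closed_set; apply; first exact: setU11.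
  move=> a b /setU1P[->|/bigcupP[w wN aw]] /andP[ab nab].
    have [E|nby] := eqVneq b y; first by rewrite E eqxx in nab.
    by apply: setU1r; apply/bigcupP; exists b; rewrite ?mem_side // !inE nby.
  have [->|nbx] := eqVneq b x; first exact: setU11.
  apply: setU1r; apply/bigcupP; exists w => //.
  have wx : adj w x by move: wN; rewrite !inE adj_sym => /andP[].
  have nax : a != x by apply: contraTneq aw => ->; apply: bridge.
  move: aw; rewrite !side_avoid // => aw.
  by apply: connect_trans aw (connect1 _); rewrite /avoid ab nbx nax.
case/setU1P=> [->|/bigcupP[w]]; first exact: mem_side.
rewrite !inE => /andP[nwy xw].
have wx : adj w x by rewrite adj_sym.
have -> : connect (adj_minus_edge w x) w u = connect (avoid x) w u.
  by rewrite -side_avoid // inE.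
move=> wu; apply: (@connect_trans _ _ w).
  apply: connect1; rewrite /adj_minus_edge xw; apply/eqP => /setP/(_ w).
  by rewrite !inE eqxx orbT (negbTE nwy) orbF eq_sym (negbTE (adj_neq xw)).
by apply: connect_sub wu => a b /(avoid_minus y) ab; apply: connect1.
Qed.

Lemma side_disjoint (x w w' : T) : adj w x -> adj w' x -> w != w' ->
  [disjoint side w x & side w' x].
Proof.
move=> wx w'x neq; rewrite -setI_eq0; apply/eqP/setP=> u; rewrite [RHS]inE inE.
apply/negP; rewrite !side_avoid // => /andP[wu w'u].
have sav : symmetric (avoid x).
  by move=> a b; rewrite /avoid adj_sym; congr (_ && _); rewrite andbC.
have w'S : w' \in side w x.
  rewrite side_avoid //; apply: connect_trans wu _.
  by rewrite (sym_connect_sym sav).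
have := bridge wx; rewrite (side_step w'S) //.
rewrite /adj_minus_edge w'x; apply/eqP => /setP/(_ w').
by rewrite !inE eqxx (negbTE (adj_neq w'x)) orbF eq_sym (negbTE neq).
Qed.

Lemma side_opposite (x y : T) : adj x y ->
  side x y :|: side y x = setT /\ [disjoint side x y & side y x].
Proof.
move=> xy; split.
  apply/eqP; rewrite -subTset; apply/subsetP => u _; have [_ con _] := treeT.
  apply: (connect_closed_set (con x u)); first by rewrite inE mem_side.
  move=> a b aS ab; have [E|nab] := eqVneq [set a; b] [set x; y].
    have : b \in [set x; y] by rewrite -E !inE eqxx orbT.
    by rewrite !inE => /orP[] /eqP ->; rewrite connect0 ?orbT.
  have mab : adj_minus_edge x y a b by rewrite /adj_minus_edge ab.
  case/setUP: aS => aS; apply/setUP; [left|right]; apply: side_step aS _ => //.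
  by rewrite minusC.
rewrite -setI_eq0; apply/eqP/setP=> u; rewrite [RHS]inE inE.
apply/negP => /andP[xu yu]; have /negP := bridge xy; apply.
move: xu yu; rewrite !inE (eq_connect (minusC y x)) => xu yu.
apply: connect_trans xu _; by rewrite (sym_connect_sym (minus_sym x y)).
Qed.

End TreeSides.

Section RankDecomposition.

Variables (G T : sgraph) (L : G -> T).
Hypothesis decL : rank_decomposition L.

Definition tree_parts (F : {set {set G}}) : Prop :=
  forall X, X \in F -> exists x y, adj x y /\ X = edge_part L x y.

Lemma edge_part_laminar (x y : T) : adj x y -> exists F : {set {set G}},
  laminar_decomposition (edge_part L x y) F /\ tree_parts F.
Proof.
have [treeT deg3 injL imL] := decL.
move: {2}#|side x y| (leqnn #|side x y|) => n.
elim: n x y => [|n IH] x y len xy.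
  by move: len; rewrite leqn0 cards_eq0 => /eqP S0; have := mem_side x y; rewrite S0 inE.
have memE v u w : (v \in edge_part L u w) = (L v \in side u w) by rewrite !inE.
set N := [set w | adj x w].
have yN : y \in N by rewrite inE.
have sU := sideU treeT xy.
have adjN w : w \in N :\ y -> adj w x by rewrite !inE adj_sym => /andP[].
have IHw w : w \in N :\ y -> exists F : {set {set G}},
    laminar_decomposition (edge_part L w x) F /\ tree_parts F.
  move=> wN; have wx := adjN w wN; apply: IH => //.
  rewrite -ltnS; apply: leq_trans len; apply: proper_card; apply/properP; split.
    by rewrite sU; apply: subset_trans (subsetUr _ _); apply: (bigcup_max w).
  by exists x; [apply: mem_side | apply: bridge].
have cN : #|N| = #|N :\ y|.+1 by rewrite (cardsD1 y) yN.
have degx : degree x = #|N :\ y|.+1 by rewrite -cN.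
have le2 : #|N :\ y| <= 2 by rewrite -ltnS -degx.
have [N0|] := eqVneq #|N :\ y| 0.
  have : x \in L @: [set: G] by rewrite imL inE degx N0.
  case/imsetP=> v _ xL.
  have -> : edge_part L x y = [set v].
    apply/setP=> u; rewrite memE sU (cards0_eq N0) big_set0 setU0 !inE xL.
    exact: inj_eq.
  exists [set [set v]]; split; first exact: laminar_set1.
  move=> X /set1P ->; exists x, y; split=> //.
  apply/setP=> u; rewrite memE sU (cards0_eq N0) big_set0 setU0 !inE xL.
  exact/esym/inj_eq.
rewrite -lt0n => N1.
have xnL v : (L v == x) = false.
  apply: contraTF N1 => /eqP E; have : L v \in leaves T by rewrite -imL imset_f.
  by rewrite inE E degx eqSS => /eqP ->.
have partE v : (v \in edge_part L x y) = (L v \in \bigcup_(w in N :\ y) side w x).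
  by rewrite memE sU in_setU1 xnL.
have [/eqP/cards1P[w Nw]|N2] := eqVneq #|N :\ y| 1.
  have [|F [lamF treeF]] := IHw w; first by rewrite Nw set11.
  have -> : edge_part L x y = edge_part L w x; last by exists F.
  by apply/setP=> v; rewrite partE Nw big_set1 memE.
have c2 : #|N :\ y| == 2 by rewrite eqn_leq le2 ltn_neqAle eq_sym N2.
have [w [w' [nww' Nww']]] := cards2P _ c2.
have wN : w \in N :\ y by rewrite Nww' !inE eqxx.
have w'N : w' \in N :\ y by rewrite Nww' !inE eqxx orbT.
have [F [lamF tF]] := IHw w wN; have [F' [lamF' tF']] := IHw w' w'N.
have E : edge_part L x y = edge_part L w x :|: edge_part L w' x.
  apply/setP=> v; rewrite partE Nww' big_setU1 /=; last by rewrite inE.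
  by rewrite big_set1 !in_setU !memE.
exists (edge_part L x y |: (F :|: F')); split.
  rewrite E; apply: laminar_join => //.
  rewrite -setI_eq0; apply/eqP/setP=> v; rewrite [RHS]inE inE !memE.
  apply/negP => /andP[v1 v2].
  have d := side_disjoint treeT (adjN w wN) (adjN w' w'N) nww'.
  by rewrite (disjointFr d v1) in v2.
move=> X /setU1P[->|/setUP[/tF|/tF']] //.
by exists x, y.
Qed.

Lemma rank_decomposition_laminar : 0 < #|G| -> exists F : {set {set G}},
  laminar_decomposition setT F /\
  (forall X, X \in F -> X = setT \/ exists x y, adj x y /\ X = edge_part L x y).
Proof.
have [treeT _ injL imL] := decL.
case/card_gt0P=> v _.
have : L v \in leaves T by rewrite -imL imset_f.
rewrite inE => /eqP deg1.
have /card_gt0P[y] : 0 < degree (L v) by rewrite deg1.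
rewrite inE; move: (L v) {deg1} => x xy.
have yx : adj y x by rewrite adj_sym.
have [F1 [lam1 t1]] := edge_part_laminar xy.
have [F2 [lam2 t2]] := edge_part_laminar yx.
have [UT dU] := side_opposite treeT xy.
have ET : edge_part L x y :|: edge_part L y x = setT.
  apply/setP=> u; rewrite [RHS]inE; have : L u \in side x y :|: side y x by rewrite UT inE.
  by rewrite !inE.
exists (setT |: (F1 :|: F2)); split.
  rewrite -{1 2}ET; apply: laminar_join => //.
  rewrite -setI_eq0; apply/eqP/setP=> u; rewrite [RHS]inE inE.
  apply/negP => /andP[u1 u2].
  have v1 : L u \in side x y by move: u1; rewrite !inE.
  have v2 : L u \in side y x by move: u2; rewrite !inE.
  by rewrite (disjointFr dU v1) in v2.
move=> X /setU1P[->|/setUP[/t1|/t2]]; [by left|by right|by right].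
Qed.

End RankDecomposition.

Lemma card_traces (G : sgraph) (X : {set G}) :
  #|traces (@adj G) setT X| <= 2 ^ cut_rank X.
Proof.
rewrite /cut_rank; set M := (\matrix_(i, j) _)%R.
pose ones (u : 'rV['F_2]_#|~: X|) := [set enum_val j | j : 'I_#|~: X| & u ord0 j == 1%R].
have sub : traces (@adj G) setT X \subset
    [set ones (u *m row_base M)%R | u : 'rV['F_2]_(\rank M)%R].
  apply/subsetP => t /imsetP[v vX ->].
  pose i := enum_rank_in vX v.
  have /submxP[u Eu] : (row i M <= row_base M)%MS by rewrite eq_row_base row_sub.
  apply/imsetP; exists u => //; rewrite -Eu.
  have iv : enum_val i = v by rewrite enum_rankK_in.
  apply/setP=> z; rewrite !inE andbT; apply/andP/imsetP => [[zX vz]|[j]].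
    have zC : z \in ~: X by rewrite inE.
    exists (enum_rank_in zC z); last by rewrite enum_rankK_in.
    by rewrite inE !mxE iv enum_rankK_in // vz.
  rewrite inE !mxE iv => Ej ->; have := enum_valP j; rewrite inE => -> ; split=> //.
  by move: Ej; case: (adj _ _).
apply: leq_trans (subset_leq_card sub) _; apply: leq_trans (leq_imset_card _ _) _.
by rewrite card_mx mul1n card_Fp.
Qed.

Lemma rankwidth_cograph_colorable k t : exists c, forall G : sgraph,
  rankwidth_at_most G k -> ~ ladder (@adj G) t [set: G] ->
  cograph_colorable (@adj G) c [set: G].
Proof.
have [c cP] := bounded_width_colorable t (2 ^ k).-1.
exists c => G [le1|[T [L [decL cutL]]]] nlad.
  exists (fun=> ord0) => l.
  have [->|[x xS]] := set_0Vmem [set v in [set: G] | ord0 == l]; first exact: cograph0.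
  apply: cographS (cograph1 _ x) _; apply/subsetP => y _; rewrite inE.
  by apply/eqP; apply: (fintype_le1P le1).
have [G0|G0] := posnP #|G|.
  exists (fun=> ord0) => l.
  have -> : [set v in [set: G] | ord0 == l] = set0; last exact: cograph0.
  by apply/setP=> x; have := fintype0 x G0.
have [F [lamF partF]] := rank_decomposition_laminar decL G0.
apply: (cP G (@adj G) setT F (@adj_sym G) nlad lamF) => X XF.
rewrite prednK ?expn_gt0 //.
case: (partF X XF) => [->|[x [y [xy ->]]]].
  apply: (@leq_trans #|[set set0 : {set G}]|).
    apply: subset_leq_card; apply/subsetP => s /imsetP[v _ ->].
    by rewrite inE; apply/eqP/setP => z; rewrite !inE.
  by rewrite cards1 expn_gt0.
by apply: leq_trans (card_traces _) _; rewrite leq_pexp2l ?cutL.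
Qed.

Lemma chi_leq (G : sgraph) (Q : finType) (g : G -> Q) :
  (forall x y : G, adj x y -> g x != g y) -> chi G <= #|Q|.
Proof.
move=> gP; rewrite /chi; case: ex_minnP => m _; apply.
apply/existsP; exists [ffun x => enum_rank (g x)].
apply/forallP => x; apply/forallP => y; apply/implyP => /gP.
by rewrite !ffunE (inj_eq enum_rank_inj).
Qed.

Lemma chi_cograph_cover (G : sgraph) (I : finType) (S : I -> {set G}) (A : {set G}) :
  (forall i, cograph (@adj G) (S i)) -> A \subset \bigcup_i S i ->
  chi (induced A) <= #|I| * omega (induced A).
Proof.
move=> cS cov; set w := omega _.
have [f fP] : exists f : I -> G -> nat, forall i,
    {in A :&: S i, forall x, f i x < w} /\
    {in A :&: S i &, forall x y, adj x y -> f i x != f i y}.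
  apply: (@fin_all_exists _ (fun=> G -> nat) (fun i f =>
    {in A :&: S i, forall x, f x < w} /\
    {in A :&: S i &, forall x y, adj x y -> f x != f y})) => i.
  have cAS := cographS (cS i) (subsetIr A (S i)).
  have [f [K [KA cK fK pf]]] := cograph_coloring (@adj_sym G) (@adj_irrefl G) cAS.
  exists f; split=> // x xA; apply: leq_trans (fK x xA) _.
  have KsA : K \subset A by apply: subset_trans KA (subsetIl _ _).
  pose K' : {set induced A} := [set u | val u \in K].
  have -> : #|K| = #|K'|.
    have -> : K = [set val u | u in K'].
      apply/setP=> z; apply/idP/imsetP => [zK|[u]]; last by rewrite inE => uK ->.
      by exists (exist _ z (subsetP KsA z zK)); rewrite ?inE.
    by rewrite card_imset //; apply: val_inj.
  apply: (@leq_bigmax_cond _ _ (fun B : {set induced A} => #|B|)).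
  apply/forall_inP => u; rewrite inE => uK; apply/forall_inP => v; rewrite inE => vK.
  by apply/implyP => neq; apply: cK.
have covA (u : induced A) : exists i, val u \in S i.
  by have /bigcupP[i _ ui] := subsetP cov _ (valP u); exists i.
pose idx u := xchoose (covA u).
have idxP u : val u \in A :&: S (idx u) by rewrite inE (valP u) (xchooseP (covA u)).
have colP u : f (idx u) (val u) < w by apply: (fP (idx u)).1.
rewrite -[w]card_ord -card_prod.
apply: (@chi_leq _ _ (fun u => (idx u, Ordinal (colP u)))) => u v uv.
apply/eqP => -[E Ef]; have [_ /(_ _ _ (idxP u))] := fP (idx u).
move=> /(_ (val v)); rewrite {1}E => /(_ (idxP v) uv).
by rewrite Ef E eqxx.
Qed.

Section Embedding.

Variables (V W : finType) (e : rel V) (e' : rel W) (f : V -> W).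
Hypotheses (injf : injective f) (ef : forall x y, e' (f x) (f y) = e x y).

Lemma cograph_imset (A : {set V}) : cograph e A -> cograph e' (f @: A).
Proof.
elim=> [|x|b {}A B dAB hAB _ cA _ cB].
- by rewrite imset0; apply: cograph0.
- by rewrite imset_set1; apply: cograph1.
rewrite imsetU; apply: (@cographU _ _ b) => //.
  by rewrite imset_disjoint //; apply: in2W.
by move=> _ _ /imsetP[x xA ->] /imsetP[y yB ->]; rewrite ef; apply: hAB.
Qed.

Lemma ladder_imset n (A : {set V}) : ladder e n A -> ladder e' n (f @: A).
Proof.
elim: n A => //= n IH A [a [b [S [[aA bA SA aS] [bS ea eb lS]]]]].
exists (f a), (f b), (f @: S); split; split.
- exact: imset_f.
- exact: imset_f.
- exact: imsetS.
- by rewrite mem_imset.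
- by rewrite mem_imset.
- by move=> _ /imsetP[z zS ->]; rewrite ef; apply: ea.
- by move=> _ /imsetP[z zS ->]; rewrite ef; apply: eb.
exact: IH.
Qed.

End Embedding.

Theorem theorem1p4 (C : graph_class) :
  low_rankwidth_covers C -> stable_edge_relation C -> linearly_chi_bounded C.
Proof.
move=> covC [t stC]; have [N [X [[k rkX] covX]]] := covC 1 isT.
have [c cP] := rankwidth_cograph_colorable k t.*2.
exists (N * c.+1) => G CG A; have [H [XH HU _]] := covX G CG.
have adjH i (u v : induced (H i)) : adj (val u) (val v) = adj u v by [].
have [kappa kappaP] : exists kappa : forall i, induced (H i) -> 'I_c.+1,
    forall i l, cograph (@adj (induced (H i))) [set v in setT | kappa i v == l].
  apply: (@fin_all_exists _ (fun i => induced (H i) -> 'I_c.+1)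
    (fun i kap => forall l, cograph _ [set v in setT | kap v == l])) => i.
  apply: cP => [|lad]; first exact/rkX/XH.
  by apply: (stC G CG); apply: ladder_half_graph (ladder_imset val_inj (adjH i) lad).
pose S (il : 'I_N * 'I_c.+1) := val @: [set v in setT | kappa il.1 v == il.2].
have -> : N * c.+1 = #|{: 'I_N * 'I_c.+1}| by rewrite card_prod !card_ord.
apply: (@chi_cograph_cover G _ S A) => [[i l]|].
  exact: cograph_imset val_inj (adjH i) _ (kappaP i l).
apply/subsetP => v _; have : v \in \bigcup_i H i by rewrite HU.
case/bigcupP=> i _ vH; pose u : induced (H i) := exist _ v vH.
apply/bigcupP; exists (i, kappa i u) => //.
apply/imsetP; exists u => //; by rewrite inE in_setT /=.
Qed.
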